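(* Let $N\geq 1$ be an integer and let $\delta>0$. There exists a nonnegative, compactly supported simple function $u=u_{N,\delta}\in L^\infty(\mathbb{R}^N)$, taking (exactly) five values, such that, simultaneously for every real $p\geq 1$ (that is, the same function $u$, depending only on $N$ and $\delta$, works for all $p\ge 1$), $$0<I_{\delta,p}(u)<I_{\delta,p}(u^* )<\infty,$$ where $u^*$ is the Schwarz rearrangement of $u$.
   Context: For an integer $N\ge 1$, real $p\ge 1$, $\delta>0$ and a measurable function $u:\mathbb{R}^N\to\mathbb{R}$, the nonlocal threshold functional is $$I_{\delta,p}(u):=\iint_{\{(x,y)\in\mathbb{R}^N\times\mathbb{R}^N:\ |u(x)-u(y)|>\delta\}}\frac{\delta^p}{|x-y|^{N+p}}\,dx\,dy\in[0,\infty],$$ where $|\cdot|$ is the Euclidean norm on $\mathbb{R}^N$ and the integral is with respect to Lebesgue measure. A simple function is a Lebesgue measurable function taking finitely many values. Schwarz rearrangement (symmetric decreasing rearrangement): for a measurable set $E\subset\mathbb{R}^N$ of finite Lebesgue measure, $E^*$ denotes the open ball centered at the origin with $|E^*|=|E|$ (empty if $|E|=0$). For a nonnegative measurable function $u$ on $\mathbb{R}^N$ all of whose superlevel sets $\{u>t\}$, $t>0$, have finite measure, $u^*(x):=\int_0^\infty \mathbf{1}_{\{u>t\}^*}(x)\,dt$; equivalently, $u^*$ is the radially symmetric, radially nonincreasing function with $\{u^*>t\}=\{u>t\}^*$ for all $t>0$. *)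

(* Defs.v *)
From HB Require Import structures.
From mathcomp Require Import all_boot all_order all_algebra.
From mathcomp Require Import all_classical all_reals all_analysis.
From mathcomp Require Import lra.

Set Implicit Arguments.
Unset Strict Implicit.
Unset Printing Implicit Defensive.

Import Order.TTheory GRing.Theory Num.Theory.
Import numFieldNormedType.Exports.

Local Open Scope classical_set_scope.
Local Open Scope ring_scope.

Section lebesgue_outer.
Context {R : realType} (n : nat).
Implicit Types (A : set 'rV[R]_n.+1).

Definition box (ab : 'rV[R]_n.+1 * 'rV[R]_n.+1) : set 'rV[R]_n.+1 :=
  [set x | forall i, ab.1 0 i < x 0 i <= ab.2 0 i].

Definition box_volume (ab : 'rV[R]_n.+1 * 'rV[R]_n.+1) : \bar R :=
  (\prod_i Num.max 0 (ab.2 0 i - ab.1 0 i))%:E.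

Definition box_cover A : set (nat -> 'rV[R]_n.+1 * 'rV[R]_n.+1) :=
  [set F | A `<=` \bigcup_k box (F k)].

(* Lebesgue outer measure of R^(n+1): infimum of the total volume of countable
   covers by half-open boxes. In dimension 0, excluded here, it would
   not vanish on the empty set. *)
Definition lebesgueN A : \bar R :=
  ereal_inf [set (\sum_(0 <= k <oo) box_volume (F k))%E | F in box_cover A].

Lemma box_volume_ge0 ab : (0 <= box_volume ab)%E.
Proof.
by rewrite lee_fin; apply: prodr_ge0 => i _; rewrite le_max lexx.
Qed.

Lemma lebesgueN_ge0 A : (0 <= lebesgueN A)%E.
Proof.
apply: le_ereal_inf_tmp => _ [F _ <-].
by apply: nneseries_ge0 => k _ _; exact: box_volume_ge0.
Qed.

Lemma lebesgueN0 : lebesgueN set0 = 0%E.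
Proof.
apply/eqP; rewrite eq_le lebesgueN_ge0 andbT.
apply: ereal_inf_lbound; exists (fun=> (0, 0)) => //.
rewrite eseries0// => k _ _; rewrite /box_volume big_ord_recl/=.
by rewrite subrr maxxx mul0r.
Qed.

Lemma le_lebesgueN : {homo lebesgueN : A B / A `<=` B >-> (A <= B)%E}.
Proof.
move=> A B AB; apply: ereal_inf_le_tmp => _ [F BF <-].
by exists F => //; exact: subset_trans BF.
Qed.

Lemma lebesgueN_sigma_subadditive : sigma_subadditive lebesgueN.
Proof.
move=> A; have [[i ioo]|] := pselect (exists i, lebesgueN (A i) = +oo%E).
  rewrite (eseries_pinfty _ _ ioo) ?leey// => k _.
  by rewrite -ltNye (lt_le_trans _ (lebesgueN_ge0 _)).
rewrite -forallNE => Aoo.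
apply/lee_addgt0Pr => e e0.
apply: le_trans (epsilon_trick xpredT (fun k => lebesgueN_ge0 (A k)) (ltW e0)).
have /choice[G PG] k : exists F, box_cover (A k) F /\
    (\sum_(0 <= j <oo) box_volume (F j) <=
     lebesgueN (A k) + (e / (2 ^ k.+1)%:R)%:E)%E.
  have ek : 0 < e / (2 ^ k.+1)%:R by rewrite divr_gt0// ltr0n expn_gt0.
  have fk : lebesgueN (A k) \is a fin_num.
    by rewrite ge0_fin_numE ?lebesgueN_ge0// ltey; exact/eqP/Aoo.
  have [_ [F AF <-] /ltW Fe] := lb_ereal_inf_adherent ek fk.
  by exists F.
have v0 (k : nat * nat) : (0 <= box_volume (uncurry G k))%E.
  exact: box_volume_ge0.
apply: (@le_trans _ _
    (\sum_(0 <= i <oo) \sum_(0 <= j <oo) box_volume (G i j))%E); last first.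
  apply: lee_nneseries => [k _ _|k _]; last exact: (PG k).2.
  by apply: nneseries_ge0 => j _ _; exact: box_volume_ge0.
have /card_esym/ppcard_eqP[f] := card_nat2.
apply: ge_ereal_inf; exists (\sum_(0 <= k <oo) box_volume (uncurry G (f k)))%E.
  exists (uncurry G \o f) => //= x [i _ /(PG i).1[j _ Gx]].
  by exists (f^-1%FUN (i, j)) => //=; rewrite invK ?inE.
under [leRHS]eq_eseriesr do (rewrite nneseries_esumT; last by move=> ?; exact: box_volume_ge0).
rewrite nneseries_esumT//.
rewrite [leRHS]nneseries_esumT; last first.
  by move=> k; apply: esum_ge0 => j _; exact: box_volume_ge0.
rewrite (@esum_esum _ _ _ setT (fun=> setT) (fun i j => box_volume (G i j)))//;
  last by move=> ? ? _ _; exact: box_volume_ge0.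
rewrite (@reindex_esum _ _ _ setT _ f)//.
  by rewrite le_eqVlt; apply/orP; left; apply/eqP/eq_esum => k _; case: (f k).
by rewrite (_ : _ `*`` _ = setT)//; apply/seteqP; split.
Qed.

HB.instance Definition _ := isOuterMeasure.Build R 'rV[R]_n.+1 lebesgueN
  lebesgueN0 lebesgueN_ge0 le_lebesgueN lebesgueN_sigma_subadditive.

End lebesgue_outer.
Arguments box {R n}.
Arguments lebesgueN {R}.

Section lebesgue.
Context {R : realType} (n : nat).

(* The sigma-algebra put on ['rV[R]_n.+1] is that of the Lebesgue measurable
   (Caratheodory) sets, not the Borel one; [lebesgueN n] is complete on it. *)
HB.instance Definition _ :=
  @isMeasurable.Build (caratheodory_display (@lebesgueN R n)) 'rV[R]_n.+1
    (caratheodory_measurable (@lebesgueN R n))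
    (@caratheodory_measurable_set0 _ _ _)
    (@caratheodory_measurable_setC _ _ _)
    (@caratheodory_measurable_bigcup _ _ _).

HB.instance Definition _ :=
  isMeasure.Build _ 'rV[R]_n.+1 R (@lebesgueN R n)
    (@caratheodory_measure0 _ _ _) (@caratheodory_measure_ge0 _ _ _)
    (@caratheodory_measure_sigma_additive _ _ _).

Let half i c := [set x : 'rV[R]_n.+1 | x 0 i <= c].

Lemma halfspace_measurable i c : measurable (half i c).
Proof.
apply: le_caratheodory_measurable => X.
apply: le_ereal_inf_tmp => _ [F XF <-].
pose Fl k := ((F k).1,
  \row_j (if j == i then Num.min ((F k).2 0 j) c else (F k).2 0 j)).
pose Fr k :=
  (\row_j (if j == i then Num.max ((F k).1 0 j) c else (F k).1 0 j), (F k).2).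
apply: (@le_trans _ _ (\sum_(0 <= k <oo) box_volume (Fl k) +
                       \sum_(0 <= k <oo) box_volume (Fr k))%E).
  apply: leeD; apply: ereal_inf_lbound.
  - exists Fl => // x [/XF[k _ Fx] Hx]; exists k => // j /=; rewrite mxE.
    have /andP[-> xj] := Fx j; rewrite /=; case: eqP => [ji|//].
    by rewrite le_min xj ji.
  - exists Fr => // x [/XF[k _ Fx] /negP Hx]; exists k => // j /=; rewrite mxE.
    have /andP[xj ->] := Fx j; rewrite andbT; case: eqP => [ji|//].
    by rewrite gt_max xj ji ltNge.
rewrite -nneseriesD; try by move=> *; exact: box_volume_ge0.
apply: lee_nneseries => [k _ _|k _].
  by rewrite adde_ge0//; exact: box_volume_ge0.
rewrite /box_volume -EFinD lee_fin.
pose P := \prod_(j < n.+1 | j != i) Num.max 0 ((F k).2 0 j - (F k).1 0 j).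
have Pl : \prod_(j < n.+1 | j != i) Num.max 0 ((Fl k).2 0 j - (Fl k).1 0 j) = P.
  by apply: eq_bigr => j /negPf ji; rewrite /= mxE ji.
have Pr : \prod_(j < n.+1 | j != i) Num.max 0 ((Fr k).2 0 j - (Fr k).1 0 j) = P.
  by apply: eq_bigr => j /negPf ji; rewrite /= mxE ji.
rewrite (bigD1 i)//= [X in _ + X](bigD1 i)//= [leRHS](bigD1 i)//=.
rewrite Pl Pr -/P -mulrDl; apply: ler_wpM2r.
  by apply: prodr_ge0 => j _; rewrite le_max lexx.
rewrite !mxE eqxx; move: ((F k).1 0 i) ((F k).2 0 i) => a b.
rewrite minEle !maxEle.
by repeat (case: ifPn; rewrite -?ltNge => ?); lra.
Qed.

Lemma box_measurable ab : measurable (box ab).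
Proof.
rewrite (_ : box ab = \bigcap_(i in [set: 'I_n.+1])
    ([set x : 'rV[R]_n.+1 | x 0 i <= ab.2 0 i] `\`
     [set x : 'rV[R]_n.+1 | x 0 i <= ab.1 0 i])).
  apply: fin_bigcap_measurable; first exact: finite_finset.
  by move=> i _; apply: measurableD; exact: halfspace_measurable.
apply/seteqP; split => [x abx i _|x abx i].
  by have /andP[ax xb] := abx i; split => //=; apply/negP; rewrite -ltNge.
by have [/= -> /negP] := abx i I; rewrite -ltNge => ->.
Qed.

Lemma lebesgueN_sigma_finite : sigma_finite setT (@lebesgueN R n).
Proof.
pose F k : 'rV[R]_n.+1 * 'rV[R]_n.+1 := (const_mx (- k%:R), const_mx k%:R).
exists (box \o F).
  apply/seteqP; split => // x _.
  pose M := \sum_i `|x 0 i|.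
  exists (Num.truncn M).+1 => // i; rewrite !mxE/=.
  have : `|x 0 i| < (Num.truncn M).+1%:R.
    apply: le_lt_trans (truncnS_gt M).
    by rewrite /M (bigD1 i)//= lerDl sumr_ge0.
  by rewrite ltr_norml => /andP[-> /ltW].
move=> k; split; first exact: box_measurable.
pose G j : 'rV[R]_n.+1 * 'rV[R]_n.+1 := if j is 0%N then F k else (0, 0).
apply: (@le_lt_trans _ _ (\sum_(0 <= j <oo) box_volume (G j))%E).
  by apply: ereal_inf_lbound; exists G => // x Fx; exists 0%N.
rewrite (nneseries_split 0 1)//; last by move=> *; exact: box_volume_ge0.
rewrite big_nat1 eseries0 ?adde0 ?ltry// => -[//|j] _ _.
by rewrite /box_volume big_ord_recl/= subrr maxxx mul0r.
Qed.

HB.instance Definition _ := @Measure_isSigmaFinite.Build _ _ _ (@lebesgueN R n)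
  lebesgueN_sigma_finite.

End lebesgue.

Section rearrangement.
Context {R : realType} (n : nat).
Implicit Types (E : set 'rV[R]_n.+1) (u : 'rV[R]_n.+1 -> R).

(* The norm provided by the library on ['rV[R]_n.+1] is the sup norm. *)
Definition enorm (x : 'rV[R]_n.+1) : R := Num.sqrt (\sum_i x 0 i ^+ 2).

Definition eball (r : R) : set 'rV[R]_n.+1 := [set x | enorm x < r].

(* [delta `^ p / enorm 0 `^ _] plays no role: the diagonal is outside the
   domain of integration. *)
Definition threshold_functional (delta p : R) u : \bar R :=
  (\int[lebesgueN n \x lebesgueN n]_(z in
       [set z : 'rV[R]_n.+1 * 'rV[R]_n.+1 | (delta < `|u z.1 - u z.2|)%R])
     (delta `^ p / enorm (z.1 - z.2) `^ (n.+1%:R + p))%:E)%E.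

(* For [E] of finite measure there is exactly one such radius, and it is [0],
   hence the ball is empty, when [E] is null. *)
Definition set_rearrangement E : set 'rV[R]_n.+1 :=
  eball (xget 0 [set r | 0 <= r /\ lebesgueN n (eball r) = lebesgueN n E]).

(* The integral is finite for bounded [u] (for any [u] if [x != 0]), so taking
   it real-valued loses nothing. *)
Definition schwarz_rearrangement u (x : 'rV[R]_n.+1) : R :=
  \int[lebesgue_measure]_(t in `]0%R, +oo[)
    \1_(set_rearrangement [set y | t < u y]) x.

End rearrangement.

(* Main.v *)
(* Take the values 0, 2q, 3q, 5q, 7q with q = delta/4: only the pairs (0, 5q),
   (0, 7q) and (2q, 7q) differ by more than delta. Let {u > 0} be the unit ball
   and {u >= 5q} the concentric ball of radius 1/2; rearranging u preserves both,
   hence also the contribution of the pairs of values (0, 5q) and (0, 7q), which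
   is finite. It remains to compare the contributions of {u = 2q} x {u = 7q},
   two sets of measures preserved by rearrangement. For u they are balls of
   radius 1/16 on opposite sides of the origin, with all mutual distances at
   least 5/4; for u^* they are a thin shell along the unit sphere and a ball of
   radius 1/16 around the origin, with all mutual distances at most 17/16. As
   the kernel decreases with the distance, the contribution for u is the smaller
   one, whatever p is. *)

Require Import Defs.
From mathcomp Require Import all_boot all_order all_algebra.
From mathcomp Require Import all_classical all_reals all_analysis.
From mathcomp Require Import measurable_realfun ess_sup_inf ring lra.

Set Implicit Arguments.
Unset Strict Implicit.
Unset Printing Implicit Defensive.

Import Order.TTheory GRing.Theory Num.Theory.
Import numFieldNormedType.Exports HBNNSimple.

Local Open Scope classical_set_scope.
Local Open Scope ring_scope.

(** * Lebesgue measure of boxes *)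

Section box_volume_lower_bound.
Context {R : realType}.

Let vol n (a b : 'I_n -> R) : R := \prod_i Num.max 0 (b i - a i).

Let vol_ge0 n (a b : 'I_n -> R) : 0 <= vol a b.
Proof. by apply: prodr_ge0 => i _; rewrite le_max lexx. Qed.

Let integral_step (a b c : R) : 0 <= c ->
  (\int[lebesgue_measure]_(t in setT) (c%:E * (\1_`]a, b]%classic t)%:E) =
   (c * Num.max 0 (b - a))%:E)%E.
Proof.
move=> c0; rewrite ge0_integralZl//; last first.
  by apply/measurable_EFinP; exact: measurable_indic.
rewrite integral_indic// setIT/= lebesgue_measure_itv/= lte_fin maxEle subr_ge0.
by case: ltgtP => [_|_|->]; rewrite ?subrr ?mulr0 ?mule0.
Qed.

(* Induction on the dimension: slice the box along its first coordinate and
   integrate the bound for the slices. The predicate [P] selects the boxes that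
   meet a given slice. *)
Lemma prod_le_cover n (P : pred nat) (a b : 'I_n -> R)
    (A B : nat -> 'I_n -> R) :
  (forall x : 'I_n -> R, (forall i, a i < x i <= b i) ->
     exists2 k, P k & forall i, A k i < x i <= B k i) ->
  ((\prod_i Num.max 0 (b i - a i))%:E <=
   \sum_(0 <= k <oo)
     ((P k)%:R * \prod_i Num.max 0 (B k i - A k i))%:E)%E.
Proof.
elim: n P a b A B => [|n IHn] P a b A B cov.
  (* In dimension 0 every volume is the empty product 1, so one selected box suffices, and the
     covering hypothesis supplies it. *)
  have [k Pk _] : exists2 k, P k & forall i : 'I_0, A k i < 0 <= B k i.
    have [|k Pk _] := cov (fun=> 0); [by case|by exists k => // -[]].
  rewrite (@nneseries_split _ _ 0 k.+1)/=; last first.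
    by move=> j _; rewrite lee_fin mulr_ge0// vol_ge0.
  apply: le_trans (leeDl _ _); last first.
    by apply: nneseries_ge0 => j _ _; rewrite lee_fin mulr_ge0// vol_ge0.
  rewrite big_nat_recr//= Pk mul1r !big_ord0; apply: leeDr.
  by apply: sume_ge0 => j _; rewrite lee_fin mulr_ge0// vol_ge0.
pose tl (c : 'I_n.+1 -> R) i := c (lift ord0 i).
rewrite big_ord_recl -/(vol (tl a) (tl b)).
pose I k := `]A k ord0, B k ord0]%classic.
pose w k := (P k)%:R * vol (tl (A k)) (tl (B k)).
have w0 k : 0 <= w k by rewrite mulr_ge0.
pose J := `]a ord0, b ord0]%classic.
have mJ : measurable J by exact: measurable_itv.
have mwI k :
    measurable_fun setT (fun t => ((w k)%:E * (\1_(I k) t)%:E)%E : \bar R).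
  apply/measurable_EFinP/measurable_funM => //.
  by apply: measurable_indic; exact: measurable_itv.
have -> : ((Num.max 0 (b ord0 - a ord0) * vol (tl a) (tl b))%:E =
    \int[lebesgue_measure]_(t in setT) ((vol (tl a) (tl b))%:E * (\1_J t)%:E))%E.
  by rewrite integral_step// mulrC.
have -> : (\sum_(0 <= k <oo)
     ((P k)%:R * \prod_i Num.max 0 (B k i - A k i))%:E =
    \int[lebesgue_measure]_(t in setT)
     \sum_(0 <= k <oo) ((w k)%:E * (\1_(I k) t)%:E))%E.
  rewrite integral_nneseries//; last first.
    by move=> k x _; rewrite -EFinM lee_fin mulr_ge0.
  apply: eq_eseriesr => k _.
  by rewrite integral_step// big_ord_recl /w/= mulrAC mulrA.
apply: ge0_le_integral => //.
- by move=> x _; rewrite -EFinM lee_fin mulr_ge0.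
- by apply/measurable_EFinP/measurable_funM => //; exact: measurable_indic.
- apply: ge0_emeasurable_sum => [k x _ _|k _].
    by rewrite -EFinM lee_fin mulr_ge0.
  exact: mwI.
move=> t _; rewrite [X in (_ * X%:E)%E]indicE.
case: (boolP (t \in J)) => tJ /=; last first.
  rewrite mule0; apply: nneseries_ge0 => k _ _.
  by rewrite -EFinM lee_fin mulr_ge0.
rewrite mule1.
have := IHn (fun k => P k && (t \in I k)) (tl a) (tl b)
   (fun k => tl (A k)) (fun k => tl (B k)) _.
rewrite -/(vol (tl a) (tl b)) => /(_ _)/le_trans; apply; last first.
  apply: lee_nneseries => [k _ _|k _].
    by rewrite lee_fin mulr_ge0// vol_ge0.
  rewrite -EFinM lee_fin /w indicE -/(vol _ _) mulrAC -natrM mulnb.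
  by rewrite lexx.
move=> x xab.
(* The point of the slice at [t] with remaining coordinates [x]; a box that contains it meets this
   slice. *)
have [|k Pk xk] := cov (fun i => if unlift ord0 i is Some j then x j else t).
  move=> i; case: (unliftP ord0 i) => [j ->|->]; first exact: xab.
  by move: tJ; rewrite /J inE/= in_itv.
exists k => [|i].
  rewrite Pk /I inE/= in_itv/=.
  by have := xk ord0; rewrite unlift_none.
by have := xk (lift ord0 i); rewrite liftK.
Qed.

Lemma lebesgueN_box_ge n (ab : 'rV[R]_n.+1 * 'rV[R]_n.+1) :
  (box_volume ab <= lebesgueN n (box ab))%E.
Proof.
apply: le_ereal_inf_tmp => _ [F abF <-].
have := @prod_le_cover n.+1 xpredT (fun i => ab.1 0 i) (fun i => ab.2 0 i)
  (fun k i => (F k).1 0 i) (fun k i => (F k).2 0 i) _.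
move=> /(_ _)/le_trans; apply.
  move=> x xab; have [|k _ xk] := abF (\row_i x i).
    by move=> i; rewrite mxE.
  by exists k => // i; have := xk i; rewrite mxE.
by apply: lee_nneseries => [k _ _|k _]; rewrite mul1r// box_volume_ge0.
Qed.

Lemma lebesgueN_box_le n (ab : 'rV[R]_n.+1 * 'rV[R]_n.+1) :
  (lebesgueN n (box ab) <= box_volume ab)%E.
Proof.
(* The box alone, padded to a sequence by degenerate boxes, whose volume is 0 because the product
   has at least one factor. *)
pose G j : 'rV[R]_n.+1 * 'rV[R]_n.+1 := if j is 0%N then ab else (0, 0).
apply: (@le_trans _ _ (\sum_(0 <= j <oo) box_volume (G j))%E).
  by apply: ereal_inf_lbound; exists G => // x Fx; exists 0%N.
rewrite (nneseries_split 0 1)//; last by move=> *; exact: box_volume_ge0.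
rewrite big_nat1 eseries0 ?adde0// => -[//|j] _ _.
by rewrite /box_volume big_ord_recl/= subrr maxxx mul0r.
Qed.

End box_volume_lower_bound.

(** * Lebesgue measure under dilations and translations *)

Section affine.
Context {R : realType} (n : nat).
Implicit Types (A : set 'rV[R]_n.+1) (c : 'rV[R]_n.+1).

(** The map sends half-open boxes to half-open boxes and multiplies their volume by [s ^+ n.+1], so
    every cover of [A] yields one of the image. *)
Lemma lebesgueN_affine_le A (s : R) c : 0 < s ->
  (lebesgueN n [set (s *: x + c)%R | x in A] <= (s ^+ n.+1)%:E * lebesgueN n A)%E.
Proof.
move=> s0; have sn0 : 0 < s ^+ n.+1 by rewrite exprn_gt0.
rewrite -lee_pdivrMl//; apply: le_ereal_inf_tmp => _ [F AF <-].
rewrite lee_pdivrMl// -nneseriesZl//; last by move=> *; exact: box_volume_ge0.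
apply: ereal_inf_lbound.
exists (fun k => (s *: (F k).1 + c, s *: (F k).2 + c)).
  move=> _ [x Ax <-]; have [k _ xk] := AF x Ax; exists k => // i.
  by rewrite /= !mxE ltrD2r lerD2r ltr_pM2l// ler_pM2l//; exact: xk.
apply: eq_eseriesr => k _; rewrite /box_volume -EFinM; congr EFin.
rewrite -[X in s ^+ X](card_ord n.+1) -prodr_const -big_split/=.
apply: eq_bigr => i _; rewrite !mxE maxr_pMr ?(ltW s0)// mulr0.
by congr (Num.max 0 _); ring.
Qed.

(** The missing inequality is the previous one for the inverse map, which is again a dilation
    followed by a translation. *)
Lemma lebesgueN_affine A (s : R) c : 0 < s ->
  (lebesgueN n [set (s *: x + c)%R | x in A] = (s ^+ n.+1)%:E * lebesgueN n A)%E.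
Proof.
move=> s0; apply/eqP; rewrite eq_le lebesgueN_affine_le//=.
have sn0 : 0 < s ^+ n.+1 by rewrite exprn_gt0.
rewrite -lee_pdivlMl// -exprVn.
have si0 : 0 < s^-1 by rewrite invr_gt0.
apply: le_trans (lebesgueN_affine_le [set (s *: x + c)%R | x in A]
  (- (s^-1 *: c)) si0).
apply: le_lebesgueN => x Ax; exists (s *: x + c); first by exists x.
by rewrite scalerDr scalerA mulVf ?gt_eqF// scale1r addrK.
Qed.

End affine.

(** * The Euclidean norm, its balls and their measure *)

Section euclidean_norm.
Context {R : realType} (n : nat).
Implicit Types (x y c : 'rV[R]_n.+1) (r : R).

Let sumsq_ge0 x : 0 <= \sum_i x 0 i ^+ 2.
Proof. by apply: sumr_ge0 => i _; exact: sqr_ge0. Qed.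

Lemma enorm_ge0 x : 0 <= enorm x.
Proof. exact: sqrtr_ge0. Qed.

Lemma sqr_enorm x : enorm x ^+ 2 = \sum_i x 0 i ^+ 2.
Proof. exact: (sqr_sqrtr (sumsq_ge0 x)). Qed.

Lemma enormZ r x : enorm (r *: x) = `|r| * enorm x.
Proof.
rewrite /enorm -sqrtr_sqr -sqrtrM ?sqr_ge0// mulr_sumr.
by congr Num.sqrt; apply: eq_bigr => i _; rewrite mxE exprMn.
Qed.

Lemma enormN x : enorm (- x) = enorm x.
Proof. by rewrite -scaleN1r enormZ normrN1 mul1r. Qed.

Lemma enormB x y : enorm (x - y) = enorm (y - x).
Proof. by rewrite -enormN opprB. Qed.

Lemma le_coord_enorm x i : `|x 0 i| <= enorm x.
Proof.
rewrite -sqrtr_sqr ler_wsqrtr// (bigD1 i)//= lerDl.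
by apply: sumr_ge0 => j _; exact: sqr_ge0.
Qed.

Lemma enorm_eq0 x : enorm x = 0 -> x = 0.
Proof.
move=> x0; apply/rowP => i; rewrite mxE; apply/eqP.
by rewrite -normr_eq0 eq_le normr_ge0 -{1}x0 le_coord_enorm.
Qed.

Lemma enorm_delta r i : enorm (r *: delta_mx 0 i : 'rV[R]_n.+1) = `|r|.
Proof.
rewrite enormZ /enorm (bigD1 i)//= mxE !eqxx/= big1.
  by rewrite addr0 expr1n sqrtr1 mulr1.
by move=> j /negPf ji; rewrite mxE eqxx ji expr0n.
Qed.

Lemma ler_enormD x y : enorm (x + y) <= enorm x + enorm y.
Proof.
have [/enorm_eq0->|x0] := eqVneq (enorm x) 0.
  by rewrite add0r lerDr enorm_ge0.
have [/enorm_eq0->|y0] := eqVneq (enorm y) 0.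
  by rewrite addr0 lerDl enorm_ge0.
have {}x0 : 0 < enorm x by rewrite lt_neqAle eq_sym x0 enorm_ge0.
have {}y0 : 0 < enorm y by rewrite lt_neqAle eq_sym y0 enorm_ge0.
rewrite -(@ler_pXn2r _ 2)// ?nnegrE ?enorm_ge0 ?addr_ge0 ?enorm_ge0//.
(* convexity of the square gives (x + y)^2 <= (1 + b/a) x^2 + (1 + a/b) y^2 *)
set a := enorm x in x0 *; set b := enorm y in y0 *.
have -> : (a + b) ^+ 2 = (1 + b / a) * a ^+ 2 + (1 + a / b) * b ^+ 2.
  by field; rewrite !gt_eqF.
rewrite !sqr_enorm !mulr_sumr -big_split/=; apply: ler_sum => i _.
rewrite mxE; set u := x 0 i; set v := y 0 i.
rewrite -subr_ge0.
have -> : (1 + b / a) * u ^+ 2 + (1 + a / b) * v ^+ 2 - (u + v) ^+ 2 =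
  (b * u - a * v) ^+ 2 / (a * b) by field; rewrite !gt_eqF.
by rewrite divr_ge0 ?sqr_ge0// mulr_ge0 ?ltW.
Qed.

Lemma ler_enorm_dist x y : enorm x - enorm y <= enorm (x - y).
Proof. by rewrite lerBlDr -{1}(subrK y x) ler_enormD. Qed.

Definition disc c r : set 'rV[R]_n.+1 := [set x | enorm (x - c) < r].

Lemma disc0 r : disc 0 r = eball r.
Proof. by rewrite /disc /eball; apply: eq_set => x; rewrite subr0. Qed.

Lemma subset_eball r1 r2 : r1 <= r2 -> eball r1 `<=` (eball r2 : set 'rV[R]_n.+1).
Proof. by move=> r12 x /= /lt_le_trans; exact. Qed.

Lemma eball_eq0 r : r <= 0 -> eball r = set0 :> set 'rV[R]_n.+1.
Proof.
move=> r0; apply/seteqP; split => // x /= xr.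
by have := lt_le_trans xr r0; rewrite ltNge enorm_ge0.
Qed.

Lemma disc_affine c r : 0 < r -> disc c r = [set r *: x + c | x in eball 1].
Proof.
move=> r0; apply/seteqP; split => [x xr|_ [x x1 <-]] /=.
  exists (r^-1 *: (x - c)); last first.
    by rewrite scalerA mulfV ?gt_eqF// scale1r subrK.
  by rewrite /eball/= enormZ gtr0_norm ?invr_gt0// mulrC ltr_pdivrMr// mul1r.
by rewrite /disc/= addrK enormZ gtr0_norm// -[ltRHS]mulr1 ltr_pM2l.
Qed.

Lemma measurable_enorm d (T : measurableType d) (f : T -> 'rV[R]_n.+1) :
  (forall i, measurable_fun setT (fun t => f t 0 i)) ->
  measurable_fun setT (fun t => enorm (f t)).
Proof.
move=> mf.
have msqrt : measurable_fun setT (@Num.sqrt R).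
  by apply: continuous_measurable_fun; exact: sqrt_continuous.
have msum : measurable_fun setT (fun t => \sum_i f t 0 i ^+ 2).
  by apply: measurable_sum => i; exact: measurable_funX.
exact: measurableT_comp msqrt msum.
Qed.

Lemma measurable_coord i : measurable_fun setT (fun x : 'rV[R]_n.+1 => x 0 i).
Proof.
apply: (measurability _ (RGenOInfty.measurableE R)) => //.
move=> _ [_ [r ->] <-]; rewrite setTI.
rewrite (_ : _ @^-1` _ = ~` [set x : 'rV[R]_n.+1 | x 0 i <= r]).
  by apply: measurableC; exact: halfspace_measurable.
apply/seteqP; split => x /=; rewrite in_itv/= andbT.
  by rewrite ltNge => /negP.
by move=> /negP; rewrite -ltNge.
Qed.

Lemma measurable_disc c r : measurable (disc c r).
Proof.
rewrite -[X in measurable X]setTI.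
have : measurable_fun setT (fun x : 'rV[R]_n.+1 => enorm (x - c)).
  apply: measurable_enorm => i.
  under eq_fun do rewrite !mxE.
  by apply: measurable_funB => //; exact: measurable_coord.
move=> /(_ measurableT `]-oo, r[%classic (measurable_itv _)).
by congr measurable; apply/seteqP; split => x /=; rewrite in_itv.
Qed.

Lemma measurable_eball r : measurable (eball r : set 'rV[R]_n.+1).
Proof. by rewrite -disc0; exact: measurable_disc. Qed.

Definition ball_volume : R := fine (lebesgueN n (eball 1)).

Lemma lebesgueN_ball1_fin : lebesgueN n (eball 1 : set 'rV[R]_n.+1) \is a fin_num.
Proof.
rewrite ge0_fin_numE ?lebesgueN_ge0//.
apply: le_lt_trans (le_trans _ (lebesgueN_box_le (const_mx (-1), const_mx 1))) _.
  apply: le_lebesgueN => x x1 i; rewrite !mxE.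
  have := le_lt_trans (le_coord_enorm x i) x1.
  by rewrite ltr_norml => /andP[-> /ltW].
exact: ltry.
Qed.

Lemma ball_volume_gt0 : 0 < ball_volume.
Proof.
rewrite fine_gt0//; apply/andP; split; last first.
  by rewrite -ge0_fin_numE ?lebesgueN_ge0// lebesgueN_ball1_fin.
(* The cube of side [h] lies in the unit ball: the n+1 squared coordinates are at most [h] each, and
   (n+1)/(n+2) < 1. *)
pose h : R := n.+2%:R^-1.
have h0 : 0 < h by rewrite invr_gt0.
apply: (@lt_le_trans _ _ (lebesgueN n (box (0 : 'rV[R]_n.+1, const_mx h)))).
  apply: lt_le_trans (lebesgueN_box_ge _).
  rewrite lte_fin; apply: prodr_gt0 => i _.
  by rewrite !mxE subr0 lt_max h0 orbT.
apply: le_lebesgueN => x xh; rewrite /eball/=.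
rewrite -(@ltr_pXn2r _ 2)// ?nnegrE ?enorm_ge0// sqr_enorm expr1n.
apply: (@le_lt_trans _ _ (\sum_(i < n.+1) h)).
  apply: ler_sum => i _; have /andP[] := xh i; rewrite !mxE => x0 xih.
  rewrite expr2; apply: (le_trans _ xih); rewrite ler_piMr ?(ltW x0)//.
  by apply: (le_trans xih); rewrite invf_le1// ler1n.
by rewrite sumr_const card_ord -mulr_natl ltr_pdivrMr// mul1r ltr_nat.
Qed.

Lemma lebesgueN_disc c r : 0 <= r ->
  lebesgueN n (disc c r) = (r ^+ n.+1 * ball_volume)%:E.
Proof.
rewrite le_eqVlt => /predU1P[<-|r0].
  rewrite expr0n mul0r (_ : disc c 0 = set0) ?measure0//.
  apply/seteqP; split => // x; rewrite /disc/=.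
  by rewrite ltNge enorm_ge0.
rewrite disc_affine// lebesgueN_affine// EFinM.
by rewrite fineK// lebesgueN_ball1_fin.
Qed.

Lemma lebesgueN_eball r : 0 <= r ->
  lebesgueN n (eball r) = (r ^+ n.+1 * ball_volume)%:E.
Proof. by rewrite -disc0; exact: lebesgueN_disc. Qed.

Lemma lebesgueN_setD (A B : set 'rV[R]_n.+1) (a b : R) :
  measurable A -> measurable B -> B `<=` A ->
  lebesgueN n A = a%:E -> lebesgueN n B = b%:E ->
  lebesgueN n (A `\` B) = (a - b)%:E.
Proof.
move=> mA mB BA Aa Bb; rewrite EFinB -Aa -Bb -[in X in (_ - X)%E](setIidr BA).
by apply: measureD => //; rewrite [ltLHS]Aa ltry.
Qed.

(** The radius picked by [xget] is forced: since the unit ball has positive finite volume, the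
    volume of a ball determines its nonnegative radius. *)
Lemma set_rearrangementE (E : set 'rV[R]_n.+1) r : 0 <= r ->
  lebesgueN n E = (r ^+ n.+1 * ball_volume)%:E ->
  set_rearrangement E = eball r.
Proof.
move=> r0 Er; congr eball.
case: xgetP => [s _ [s0]|/(_ r)[]]; last by split => //; rewrite lebesgueN_eball.
rewrite lebesgueN_eball// Er => -[] /(mulIf (lt0r_neq0 ball_volume_gt0)) /eqP.
by rewrite eqrXn2// => /eqP.
Qed.

End euclidean_norm.

(** * Five-valued functions built on nested sets *)

Section layered.
Context {R : realType} {T : Type}.
Implicit Types (q t : R) (F : nat -> set T) (x y : T).

(* The superlevel sets are [F 0 >= F 1 >= F 2 >= F 3]. Of the values 0, 2q,
   3q, 5q and 7q, only the pairs (0, 5q), (0, 7q) and (2q, 7q) differ by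
   more than 4q. *)
Definition layered q F x : R :=
  q * (2 * \1_(F 0%N) x + \1_(F 1%N) x + 2 * \1_(F 2%N) x + 2 * \1_(F 3%N) x).

Definition nested F :=
  [/\ F 1%N `<=` F 0%N, F 2%N `<=` F 1%N & F 3%N `<=` F 2%N].

(** Each case fixes the value and records membership in all four sets, so that a case analysis
    leaves only linear arithmetic and propositional goals. *)
Variant layered_spec q F x : R -> Prop :=
| Layer0 of ~ F 0%N x & ~ F 1%N x & ~ F 2%N x & ~ F 3%N x : layered_spec q F x 0
| Layer1 of F 0%N x & ~ F 1%N x & ~ F 2%N x & ~ F 3%N x :
    layered_spec q F x (2 * q)
| Layer2 of F 0%N x & F 1%N x & ~ F 2%N x & ~ F 3%N x :
    layered_spec q F x (3 * q)
| Layer3 of F 0%N x & F 1%N x & F 2%N x & ~ F 3%N x :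
    layered_spec q F x (5 * q)
| Layer4 of F 0%N x & F 1%N x & F 2%N x & F 3%N x : layered_spec q F x (7 * q).

Lemma layeredP q F x : nested F -> layered_spec q F x (layered q F x).
Proof.
move=> [F10 F21 F32]; rewrite /layered !indicE.
have [/set_mem F3|/negP F3] := boolP (x \in F 3%N).
  have F2 := F32 _ F3; have F1 := F21 _ F2; have F0 := F10 _ F1.
  rewrite !mem_set//=; set v := (v in layered_spec _ _ _ v).
  by rewrite (_ : v = 7 * q); [constructor|rewrite /v/=; ring].
have {}F3 : ~ F 3%N x by move=> /mem_set.
have [/set_mem F2|/negP F2] := boolP (x \in F 2%N).
  have F1 := F21 _ F2; have F0 := F10 _ F1.
  rewrite !mem_set//=; set v := (v in layered_spec _ _ _ v).
  by rewrite (_ : v = 5 * q); [constructor|rewrite /v/=; ring].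
have {}F2 : ~ F 2%N x by move=> /mem_set.
have [/set_mem F1|/negP F1] := boolP (x \in F 1%N).
  have F0 := F10 _ F1.
  rewrite !mem_set//=; set v := (v in layered_spec _ _ _ v).
  by rewrite (_ : v = 3 * q); [constructor|rewrite /v/=; ring].
have {}F1 : ~ F 1%N x by move=> /mem_set.
have [/set_mem F0|/negP F0] := boolP (x \in F 0%N).
  set v := (v in layered_spec _ _ _ v).
  by rewrite (_ : v = 2 * q); [constructor|rewrite /v/=; ring].
have {}F0 : ~ F 0%N x by move=> /mem_set.
set v := (v in layered_spec _ _ _ v).
by rewrite (_ : v = 0); [constructor|rewrite /v/=; ring].
Qed.

Lemma superlevel_layered q F t : 0 < q -> nested F -> 0 <= t ->
  [set x | t < layered q F x] =
    if t < 2 * q then F 0%N else if t < 3 * q then F 1%N else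
    if t < 5 * q then F 2%N else if t < 7 * q then F 3%N else set0.
Proof.
move=> q0 nF t0; apply/seteqP; split => x /=.
  by case: (layeredP q x nF) => // ? ? ? ?; do ! case: ifPn => //; lra.
case: (layeredP q x nF) => // ? ? ? ?; do ! case: ifPn => //; rewrite -?leNgt; lra.
Qed.

(** The value pairs (0, 5q) and (0, 7q) together fill the first piece, which thus depends on [F 0]
    and [F 2] only; (2q, 7q) gives the second. The values 3q and 7q differ by exactly 4q and are
    excluded by the strict inequality. *)
Lemma interaction_layered q F : 0 < q -> nested F ->
  [set z : T * T | 4 * q < `|layered q F z.1 - layered q F z.2|] =
  (F 2%N `*` ~` F 0%N `|` ~` F 0%N `*` F 2%N) `|`
  ((F 0%N `\` F 1%N) `*` F 3%N `|` F 3%N `*` (F 0%N `\` F 1%N)).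
Proof.
move=> q0 nF; apply/seteqP; split => -[x y] /=; rewrite ltr_normr.
  by case: (layeredP q x nF); case: (layeredP q y nF) => *;
    first [lra | left; left; split; assumption | left; right; split; assumption
          | right; left; split; [split|]; assumption
          | right; right; split; [|split]; assumption ].
case: (layeredP q x nF); case: (layeredP q y nF) => y0 y1 y2 y3 x0 x1 x2 x3;
  first [move=> _; apply/orP; lra | tauto].
Qed.

End layered.

(** * Schwarz rearrangement of a layered function *)

Section schwarz_layered.
Context {R : realType} {n : nat}.

(** Every superlevel set at a level t >= 0 is some [F i] or empty, and is rearranged into the
    corresponding ball or the empty set. These are the superlevel sets of the layered function of
    the balls. *)
Lemma schwarz_layered (q : R) (F : nat -> set 'rV[R]_n.+1) (r : nat -> R) :
  0 < q -> nested F ->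
  (forall i, 0 <= r i) -> r 1%N <= r 0%N -> r 2%N <= r 1%N -> r 3%N <= r 2%N ->
  (forall i, lebesgueN n (F i) = lebesgueN n (eball (r i))) ->
  schwarz_rearrangement (layered q F) = layered q (fun i => eball (r i)).
Proof.
move=> q0 nF r0 r10 r21 r32 Fr.
have nB : nested (fun i => eball (r i) : set 'rV[R]_n.+1).
  by split; exact: subset_eball.
have rE i : set_rearrangement (F i) = eball (r i).
  by apply: set_rearrangementE => //; rewrite Fr lebesgueN_eball.
have r0E : set_rearrangement set0 = set0 :> set 'rV[R]_n.+1.
  rewrite (@set_rearrangementE _ _ _ 0) ?measure0 ?expr0n ?mul0r//.
  exact: eball_eq0.
apply/funext => x; rewrite /schwarz_rearrangement.
set U := layered q (fun i => eball (r i)).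
have U0 : 0 <= U x by rewrite /U; case: (layeredP q x nB) => *; lra.
(* At a fixed [x] the layer-cake integrand is the indicator of the interval from 0 to [U x], whose
   length is [U x]. *)
rewrite (_ : \int[_]_(t in _) _ =
    \int[lebesgue_measure]_(t in `]0, +oo[) \1_(`]0, U x[) t); last first.
  apply: eq_Rintegral => t; rewrite inE/= in_itv/= andbT => t0.
  have -> : set_rearrangement [set y | t < layered q F y] = [set y | t < U y].
    rewrite !superlevel_layered ?(ltW t0)//.
    by do ! case: ifP.
  rewrite !indicE; congr (_ %:R); congr nat_of_bool.
  by apply/idP/idP; rewrite !inE/= in_itv/= t0.
rewrite /Rintegral integral_indic//= setIidl.
  rewrite lebesgue_measure_itv/= lte_fin; case: ltP => [_|Ux0].
    by rewrite oppr0 adde0.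
  by apply/eqP; rewrite eq_le U0.
by move=> t /=; rewrite !in_itv/= => /andP[->].
Qed.

End schwarz_layered.

(** * Rectangles united with their transposes *)

Section sym_rect.
Context {T : Type}.
Implicit Types E G : set T.

(** Kernel and threshold condition are symmetric in the two points, so both orders of a pair of
    layers are treated at once. *)
Definition sym_rect E G : set (T * T) := E `*` G `|` G `*` E.

Lemma sym_rect_bigcup E (G : nat -> set T) :
  sym_rect E (\bigcup_k G k) = \bigcup_k sym_rect E (G k).
Proof.
apply/seteqP; split => [[x y] /= [[? [k _ ?]]|[[k _ ?] ?]]|
                        [x y] [k _ /= [[? ?]|[? ?]]]].
- by exists k => //; left.
- by exists k => //; right.
- by left; split => //; exists k.
- by right; split => //; exists k.
Qed.

Lemma sym_rect_disjoint E E' G G' : G `&` G' = set0 -> E `&` G' = set0 ->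
  sym_rect E G `&` sym_rect E' G' = set0.
Proof.
move=> /seteqP[+ _] /seteqP[+ _] => GG EG.
apply/seteqP; split => //= -[x y] /= [[[Ex Gy]|[Gx Ey]] [[E'x G'y]|[G'x E'y]]].
- exact: (GG y).
- exact: (EG x).
- exact: (EG y).
- exact: (GG x).
Qed.

End sym_rect.

(** * Bounds for the integral of the kernel *)

Section kernel.
Context {R : realType} {n : nat}.
Variables delta p : R.
Hypotheses (delta_gt0 : 0 < delta) (p_ge1 : 1 <= p).
Implicit Types (E G : set 'rV[R]_n.+1) (a b d : R).

Let mu2 := (@lebesgueN R n \x @lebesgueN R n)%E.
Let s : R := n.+1%:R + p.

Let s_gt0 : 0 < s.
Proof. by rewrite addr_gt0// (lt_le_trans ltr01). Qed.

Definition kern (z : 'rV[R]_n.+1 * 'rV[R]_n.+1) : R :=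
  delta `^ p / enorm (z.1 - z.2) `^ (n.+1%:R + p).

Lemma kern_ge0 z : 0 <= kern z.
Proof. by rewrite divr_ge0// powR_ge0. Qed.

Lemma measurable_kern (D : set ('rV[R]_n.+1 * 'rV[R]_n.+1)) :
  measurable_fun D (EFin \o kern).
Proof.
apply: measurable_funS measurableT (@subsetT _ _) _.
apply/measurable_EFinP/measurable_funM => //.
under eq_fun do rewrite -powRN.
apply: (measurableT_comp (measurable_powR _)).
apply: measurable_enorm => i.
under eq_fun do rewrite !mxE.
apply: measurable_funB.
  exact: measurableT_comp (measurable_coord i) measurable_fst.
exact: measurableT_comp (measurable_coord i) measurable_snd.
Qed.

Lemma kern_le d z : 0 < d -> d <= enorm (z.1 - z.2) -> kern z <= delta `^ p / d `^ s.
Proof.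
move=> d0 dz; rewrite ler_pM2l ?powR_gt0// lef_pV2 ?posrE ?powR_gt0//; last first.
  exact: lt_le_trans dz.
by apply: ge0_ler_powR; rewrite ?nnegrE ?(ltW s_gt0) ?(ltW d0) ?enorm_ge0.
Qed.

(** The distance must be positive: on the diagonal the division by zero makes [kern] vanish. *)
Lemma kern_ge d z : 0 < enorm (z.1 - z.2) -> enorm (z.1 - z.2) <= d ->
  delta `^ p / d `^ s <= kern z.
Proof.
move=> z0 dz; rewrite ler_pM2l ?powR_gt0// lef_pV2 ?posrE ?powR_gt0//; last first.
  exact: lt_le_trans dz.
apply: ge0_ler_powR; rewrite ?nnegrE ?(ltW s_gt0) ?enorm_ge0//.
by rewrite (le_trans _ dz) ?enorm_ge0.
Qed.

Lemma measurable_sym_rect E G : measurable E -> measurable G ->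
  measurable (sym_rect E G).
Proof. by move=> mE mG; apply: measurableU; exact: measurableX. Qed.

Lemma measure_sym_rect E G a b : measurable E -> measurable G ->
  E `&` G = set0 -> lebesgueN n E = a%:E -> lebesgueN n G = b%:E ->
  mu2 (sym_rect E G) = (2 * (a * b))%:E.
Proof.
move=> mE mG EG Ea Gb; transitivity (mu2 (E `*` G) + mu2 (G `*` E))%E.
  rewrite /mu2 /sym_rect measureU//; try exact: measurableX.
  by rewrite -setXI EG set0X.
rewrite /mu2 !product_measure1E//= Ea Gb -!EFinM -EFinD; congr EFin; ring.
Qed.

Lemma integral_kern_le E G a b d : measurable E -> measurable G ->
  E `&` G = set0 -> lebesgueN n E = a%:E -> lebesgueN n G = b%:E ->
  0 < d -> (forall x y, E x -> G y -> d <= enorm (x - y)) ->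
  (\int[mu2]_(z in sym_rect E G) (kern z)%:E <=
   (delta `^ p / d `^ s * (2 * (a * b)))%:E)%E.
Proof.
move=> mE mG EG Ea Gb d0 dEG.
have mS := measurable_sym_rect mE mG.
rewrite EFinM -(measure_sym_rect mE mG EG Ea Gb) -integral_cst//.
apply: ge0_le_integral => //.
- by move=> z _; rewrite lee_fin kern_ge0.
- exact: measurable_kern.
move=> [x y] Sz; rewrite lee_fin; apply: kern_le => //=.
by move: Sz => [[/= Ex Gy]|[/= Gx Ey]]; [|rewrite enormB]; exact: dEG.
Qed.

Lemma integral_kern_ge E G a b d : measurable E -> measurable G ->
  E `&` G = set0 -> lebesgueN n E = a%:E -> lebesgueN n G = b%:E ->
  (forall x y, E x -> G y -> enorm (x - y) <= d) ->
  ((delta `^ p / d `^ s * (2 * (a * b)))%:E <=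
   \int[mu2]_(z in sym_rect E G) (kern z)%:E)%E.
Proof.
move=> mE mG EG Ea Gb dEG.
have mS := measurable_sym_rect mE mG.
rewrite EFinM -(measure_sym_rect mE mG EG Ea Gb) -integral_cst//.
apply: ge0_le_integral => //.
- by move=> z _; rewrite lee_fin divr_ge0// powR_ge0.
- exact: measurable_kern.
move=> [x y] Sz; rewrite lee_fin; apply: kern_ge => /=.
  (* Disjointness of [E] and [G] keeps the domain off the diagonal. *)
  rewrite lt_neqAle enorm_ge0 andbT eq_sym; apply/eqP => /enorm_eq0/eqP.
  rewrite subr_eq0 => /eqP xy; rewrite {}xy in Sz.
  have /seteqP[+ _] := EG; apply; move: Sz => [[/= Ex Gy]|[/= Gx Ey]].
    by split; [exact: Ex|exact: Gy].
  by split; [exact: Ey|exact: Gx].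
by move: Sz => [[/= Ex Gy]|[/= Gx Ey]]; [|rewrite enormB]; exact: dEG.
Qed.

(* The exterior of the unit ball is cut into dyadic annuli. *)
Lemma integral_kern_far_lty :
  (\int[mu2]_(z in sym_rect (eball 2^-1) (~` eball 1)) (kern z)%:E < +oo)%E.
Proof.
pose ann k : set 'rV[R]_n.+1 := eball (2 ^+ k.+1) `\` eball (2 ^+ k).
have annE x : (~` eball 1) x <-> exists k, ann k x.
  split=> [x1|[k [_ xk] x1]]; last first.
    by apply/xk/(subset_eball _ x1); rewrite exprn_ege1// ler1n.
  have ex : exists k, enorm x < 2 ^+ k.
    exists (Num.truncn (enorm x)).+1.
    apply: lt_trans (truncnS_gt (enorm x)) _.
    by rewrite -natrX ltr_nat ltn_expl.
  (* The least exponent is not 0, as [x] is outside the unit ball; its predecessor indexes the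
     annulus of [x]. *)
  case: (ex_minnP ex) => -[|k] xk kmin.
    by case: x1; rewrite /eball/= -(expr0 2).
  by exists k; split => // /kmin; rewrite ltnn.
have -> : ~` eball 1 = \bigcup_k ann k.
  apply/seteqP; split => x; first by move=> /annE[k ?]; exists k.
  by move=> [k _ ?]; apply/annE; exists k.
have mann k : measurable (ann k) by apply: measurableD; exact: measurable_eball.
have Eann k : eball 2^-1 `&` ann k = set0.
  apply/seteqP; split => // x [xh xk].
  have /annE : exists k, ann k x by exists k.
  by apply; apply: subset_eball xh; lra.
have mS k : measurable (sym_rect (eball 2^-1) (ann k)).
  by apply: measurable_sym_rect => //; exact: measurable_eball.
rewrite sym_rect_bigcup ge0_integral_bigcup//; last 3 first.
- exact: measurable_kern.
- by move=> z _; rewrite lee_fin kern_ge0.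
- apply: ltn_trivIset => i j ij; apply: sym_rect_disjoint => //.
  apply/seteqP; split => // x [[xj _] [_ xi]].
  apply: xi; apply: subset_eball xj.
  by rewrite ler_eXn2l// ltr1n.
pose w : R := ball_volume n.
(* Chosen so that the k-th annulus contributes at most [K] / 2^(k+1); the last factor 2 absorbs the
   shift in the exponent. *)
pose K : R :=
  delta `^ p / (2^-1 `^ s) * (2 * (2^-1 ^+ n.+1 * w * (2 ^+ n.+1 * w))) * 2.
have w0 : 0 < w := ball_volume_gt0 n.
have K0 : 0 <= K.
  by rewrite /K !mulr_ge0 ?invr_ge0 ?powR_ge0 ?exprn_ge0 ?(ltW w0).
apply: (@le_lt_trans _ _ K%:E); last exact: ltry.
(* Applied to the zero sequence, [epsilon_trick] sums the geometric series. *)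
have := epsilon_trick xpredT (fun=> lexx 0%E : (0 <= (0 : \bar R))%E) K0.
rewrite [X in (_ <= X + _)%E]eseries0// add0e => /(le_trans _); apply.
apply: lee_nneseries => [k _ _|k _].
  by apply: integral_ge0 => z _; rewrite lee_fin kern_ge0.
rewrite add0e.
have vann : lebesgueN n (ann k) = ((2 ^+ k) ^+ n.+1 * (2 ^+ n.+1 - 1) * w)%:E.
  rewrite (lebesgueN_setD (measurable_eball _) (measurable_eball _) _
    (lebesgueN_eball _ _) (lebesgueN_eball _ _)) ?exprn_ge0//; last first.
    by apply: subset_eball; rewrite ler_eXn2l// ltr1n.
  congr EFin.
  by rewrite [2 ^+ k.+1]exprS exprMn -/w; ring.
have dk : 0 < 2 ^+ k * 2^-1 :> R by rewrite mulr_gt0// exprn_gt0.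
apply: le_trans (integral_kern_le (measurable_eball _) (mann k) (Eann k)
  (lebesgueN_eball _ _) vann dk _) _ => //.
  (* The distance is at least 2^k - 1/2, hence at least 2^k / 2 because 2^k >= 1. *)
  move=> x y xh [_ /negP]; rewrite -leNgt => yk.
  rewrite enormB; apply: le_trans (ler_enorm_dist _ _).
  have : 1 <= 2 ^+ k :> R by rewrite exprn_ege1// ler1n.
  move: xh; rewrite /eball/=; lra.
rewrite lee_fin powRM ?exprn_ge0// invfM -/w.
set X : R := 2 ^+ k; set A : R := 2^-1 ^+ n.+1; set B : R := 2 ^+ n.+1.
have X1 : 1 <= X by rewrite exprn_ege1// ler1n.
have X0 : 0 < X by exact: lt_le_trans X1.
(* Kernel decay against volume growth leaves the power -p of [X]; p >= 1 and [X] >= 1 give the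
   geometric rate. *)
have XY : (X `^ s)^-1 * X ^+ n.+1 <= X^-1.
  rewrite mulrC ler_pdivrMr ?powR_gt0// mulrC ler_pdivlMr//.
  rewrite -exprSr -powR_mulrn ?(ltW X0)// ler_powR//.
  by rewrite -natr1 lerD2l.
have X2 : ((2 ^ k.+1)%:R : R) = 2 * X by rewrite natrX exprS.
rewrite X2 /K -/A -/B.
set C := delta `^ p; set h := 2^-1 `^ s.
have Ch : 0 <= C / h by rewrite divr_ge0 ?powR_ge0.
have -> : C * ((X `^ s)^-1 / h) * (2 * (A * w * (X ^+ n.+1 * (B - 1) * w))) =
  (C / h * (2 * A * w * w)) * ((X `^ s)^-1 * X ^+ n.+1 * (B - 1)) by ring.
have -> : C / h * (2 * (A * w * (B * w))) * 2 / (2 * X) =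
  (C / h * (2 * A * w * w)) * (X^-1 * B).
  by field; rewrite !gt_eqF ?powR_gt0.
have A0 : 0 <= A by rewrite exprn_ge0.
have B1 : 1 <= B by rewrite exprn_ege1// ler1n.
apply: ler_wpM2l; first by rewrite mulr_ge0// !mulr_ge0// ltW.
apply: ler_pM => //; last by rewrite gerBl.
- by rewrite mulr_ge0 ?invr_ge0 ?powR_ge0 ?exprn_ge0// ltW.
- by rewrite subr_ge0.
Qed.

End kernel.

(** * Splitting the functional into two contributions *)

Section split_functional.
Context {R : realType} {n : nat}.

(** The step delta/4 turns the threshold into 4q. The two pieces are disjoint: every pair in the
    first has a point outside [F 0], whereas both points of a pair in the second lie in [F 0]. *)
Lemma threshold_functional_layered (delta p : R)
    (F : nat -> set 'rV[R]_n.+1) :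
  0 < delta -> nested F -> (forall i, measurable (F i)) ->
  (threshold_functional delta p (layered (delta / 4) F) =
   \int[lebesgueN n \x lebesgueN n]_(z in sym_rect (F 2%N) (~` F 0%N))
     (kern delta p z)%:E +
   \int[lebesgueN n \x lebesgueN n]_(z in sym_rect (F 0%N `\` F 1%N) (F 3%N))
     (kern delta p z)%:E)%E.
Proof.
move=> delta0 nF mF; rewrite -ge0_integral_setU; last 5 first.
- by apply: measurable_sym_rect => //; exact: measurableC.
- by apply: measurable_sym_rect => //; exact: measurableD.
- exact: measurable_kern.
- by move=> z _; rewrite lee_fin kern_ge0.
- have [F10 F21 F32] := nF; apply/disj_setPS => -[x y] /=.
  by move=> [[[/F21 Fx Fy]|[Fx /F21 Fy]]
    [[[Gx Gx'] /F32/F21/F10 Gy]|[/F32/F21/F10 Gx [Gy Gy']]]].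
have q0 : 0 < delta / 4 by rewrite divr_gt0.
rewrite /threshold_functional -(interaction_layered q0 nF).
by have -> : 4 * (delta / 4) = delta by field.
Qed.

End split_functional.

(** * The five-valued example *)

Section example.
Context {R : realType} (n : nat).
Local Notation V := 'rV[R]_n.+1.

Let axis : V := delta_mx 0 0.
(** Balls of radius 1/16 around [c1] and [c4] touch from inside the spheres of radius 1 and 1/2, on
    opposite sides. The centers are 22/16 apart, which leaves 22/16 - 2/16 = 5/4 between points of
    the balls. *)
Let c1 : V := (15 / 16) *: axis.
Let c4 : V := - (7 / 16) *: axis.

Definition bump_set : set V := disc c1 (1 / 16).
Definition core_set : set V := disc c4 (1 / 16).

(* The value 2q is taken on [bump_set]. The default value of [nth] makes
   [level i] equal to [core_set] for [i >= 3]. *)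
Definition level (i : nat) : set V :=
  nth core_set [:: eball 1; eball 1 `\` bump_set; eball 2^-1] i.

Let bump_sub : bump_set `<=` eball 1.
Proof.
move=> x; rewrite /bump_set /disc /eball/= => xc.
have := ler_enormD (x - c1) c1; rewrite subrK /c1 enorm_delta -/c1.
rewrite ger0_norm//; lra.
Qed.

Let bump_far x : bump_set x -> ~ eball 2^-1 x.
Proof.
rewrite /bump_set /disc /eball/= => xc xh.
have := ler_enormD (c1 - x) x; rewrite subrK enormB {2}/c1 enorm_delta.
rewrite ger0_norm//; lra.
Qed.

Let core_sub : core_set `<=` eball 2^-1.
Proof.
move=> x; rewrite /core_set /disc /eball/= => xc.
have := ler_enormD (x - c4) c4; rewrite subrK /c4 enorm_delta -/c4.
rewrite ler0_norm; lra.
Qed.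

Lemma bump_core_dist x y : bump_set x -> core_set y -> 5 / 4 <= enorm (x - y).
Proof.
rewrite /bump_set /core_set /disc/= => xc yc.
have := ler_enormD (c1 - x) (x - y); rewrite addrA subrK enormB => xy.
have := ler_enormD (c1 - y) (y - c4); rewrite addrA subrK.
rewrite {1}/c1 /c4 -scalerBl enorm_delta -/c4 ger0_norm; lra.
Qed.

Lemma level_nested : nested level.
Proof.
split; rewrite /level/=; [by move=> x []| |exact: core_sub] => x xh.
by split; [apply: subset_eball xh; lra|move=> /bump_far].
Qed.

Lemma measurable_level i : measurable (level i).
Proof.
have me r : measurable (eball r : set V) by exact: measurable_eball.
have mb : measurable bump_set by exact: measurable_disc.
have mc : measurable core_set by exact: measurable_disc.
by case: i => [|[|[|i]]]; rewrite /level/= ?nth_nil//; exact: measurableD.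
Qed.

Lemma level0D1 : level 0 `\` level 1 = bump_set.
Proof. by rewrite /level/= setDD setIidr. Qed.

(** [rho] is the radius of the rearrangement of [level 1], the unit ball without the bump. The bound
    1/2 keeps the rearranged levels nested; it holds since the bump takes at most 1/16 of the
    volume. *)
Lemma exists_radius : exists2 rho : R, 2^-1 <= rho <= 1 &
  rho ^+ n.+1 = 1 - (1 / 16) ^+ n.+1.
Proof.
set t : R := (1 / 16) ^+ n.+1.
have t0 : 0 <= t by rewrite exprn_ge0//; lra.
have t1 : t <= 1 / 16.
  by rewrite /t exprS ler_piMr// exprn_ile1//; lra.
have h1 : 2^-1 ^+ n.+1 <= 2^-1 :> R.
  by rewrite exprS ler_piMr// exprn_ile1//; lra.
have rN : ((1 - t) `^ (n.+1%:R^-1)) ^+ n.+1 = 1 - t.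
  by rewrite -powR_mulrn ?powR_ge0// -powRrM mulVf// powRr1//; lra.
exists ((1 - t) `^ (n.+1%:R^-1)) => //; apply/andP; split.
  by rewrite -(@ler_pXn2r _ n.+1)// ?nnegrE ?powR_ge0// rN; lra.
by rewrite -(@ler_pXn2r _ n.+1)// ?nnegrE ?powR_ge0// rN expr1n; lra.
Qed.

Lemma compact_closure_eball1 (A : set V) : A `<=` eball 1 -> compact (closure A).
Proof.
move=> A1; pose K := [set v : V | forall i, `[(-1 : R), 1]%classic (v ord0 i)].
have cK : compact K.
  apply: (@rV_compact _ _ (fun=> `[(-1 : R), 1]%classic)) => i.
  exact: segment_compact.
apply: (subclosed_compact _ cK); first exact: closed_closure.
have /closure_id -> : closed K by apply: compact_closed => //; exact: norm_hausdorff.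
apply: closure_subset => x /A1 x1 i /=; rewrite in_itv/= -ler_norml.
exact: le_trans (le_coord_enorm x i) (ltW x1).
Qed.

Let axis_eball r a : eball r (a *: axis) = (- r < a < r) :> Prop.
Proof. by rewrite /eball/= enorm_delta ltr_norml. Qed.

Let axis_bump a :
  bump_set (a *: axis) = (- (1 / 16) < a - 15 / 16 < 1 / 16) :> Prop.
Proof. by rewrite /bump_set /disc/= -scalerBl enorm_delta ltr_norml. Qed.

Let axis_core a :
  core_set (a *: axis) = (- (1 / 16) < a - - (7 / 16) < 1 / 16) :> Prop.
Proof. by rewrite /core_set /disc/= -scalerBl enorm_delta ltr_norml. Qed.

Lemma level_range (q : R) : 0 < q -> (range (layered q level) #= `I_5)%card.
Proof.
move=> q0; have nL := level_nested.
pose g i : R := nth 0 [:: 0; 2; 3; 5; 7] i * q.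
have -> : range (layered q level) = g @` `I_5.
  apply/seteqP; split => [_ [x _ <-]|_ [i /= i5 <-]].
    case: (layeredP q x nL) => _ _ _ _.
    - by exists 0%N => //; rewrite /g/= mul0r.
    - by exists 1%N.
    - by exists 2%N.
    - by exists 3%N.
    - by exists 4%N.
  have [a ia] : exists a, layered q level (a *: axis) = g i.
    (* One sample point of the axis per value: outside the unit ball, the center of the bump,
       between the spheres of radius 1/2 and 1 away from the bump, the origin, the center of the
       core. *)
    exists (nth 0 [:: 2; 15 / 16; - (3 / 4); 0; - (7 / 16)] i).
    case: (layeredP q _ nL); rewrite /level/= /g !axis_eball axis_bump axis_core;
      by case: i i5 => [|[|[|[|[|//]]]]] _ /= ? ? ? ?; lra.
  by exists (a *: axis).
apply: inj_card_eq => i j /set_mem/= i5 /set_mem/= j5 /(mulIf (lt0r_neq0 q0)).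
by case: i i5 => [|[|[|[|[|//]]]]] _;
  case: j j5 => [|[|[|[|[|//]]]]] _ //= ?; exfalso; lra.
Qed.

(** Assembled term by term so that the underlying function is convertible to [layered q level],
    whose lemmas then apply directly. *)
Definition level_nnsfun (q : R) (q0 : 0 <= q) : {nnsfun V >-> R} :=
  let ind i := indic_nnsfun R (measurable_level i) in
  let ind2 i := scale_nnsfun (ind i) (ler0n R 2) in
  scale_nnsfun
    (add_nnsfun (add_nnsfun (add_nnsfun (ind2 0%N) (ind 1%N)) (ind2 2%N))
      (ind2 3%N)) q0.

Lemma finite_norm_level (q : R) : 0 < q ->
  finite_norm (@lebesgueN R n) +oo%E (layered q level).
Proof.
move=> q0; rewrite /finite_norm Lnorm.unlock; case: ifP => _; last exact: ltry.
apply: (@le_lt_trans _ _ (7 * q)%:E); last exact: ltry.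
apply/ess_supP; apply: aeW => x /=; rewrite lee_fin.
by case: (layeredP q x level_nested) => *; rewrite ger0_norm; lra.
Qed.

Lemma level_support (q : R) : 0 < q ->
  [set x | layered q level x != 0] `<=` eball 1.
Proof.
move=> q0 x /=; case: (layeredP q x level_nested) => // _ _ _ _.
by rewrite eqxx.
Qed.

Lemma lebesgueN_bump : lebesgueN n bump_set =
  ((1 / 16) ^+ n.+1 * ball_volume n)%:E.
Proof. by rewrite lebesgueN_disc//; lra. Qed.

Lemma lebesgueN_core : lebesgueN n core_set =
  ((1 / 16) ^+ n.+1 * ball_volume n)%:E.
Proof. by rewrite lebesgueN_disc//; lra. Qed.

Lemma threshold_functional_level_lt (delta p : R) : 0 < delta -> 1 <= p ->
  let u := layered (delta / 4) level in
  [/\ (0 < threshold_functional delta p u)%E,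
      (threshold_functional delta p u <
       threshold_functional delta p (schwarz_rearrangement u))%E &
      (threshold_functional delta p (schwarz_rearrangement u) < +oo)%E].
Proof.
move=> delta0 p1 /=; have q0 : 0 < delta / 4 by rewrite divr_gt0.
have [rho /andP[rho_ge rho_le] rhoE] := exists_radius.
(* Radii of the rearranged levels; the default 1/16 serves all i >= 3, matching the default
   [core_set] of [level]. *)
pose r i : R := nth (1 / 16) [:: 1; rho; 2^-1] i.
have r0 i : 0 <= r i.
  by case: i => [|[|[|i]]]; rewrite /r/= ?nth_nil//; lra.
have levelE i : lebesgueN n (level i) = lebesgueN n (eball (r i)).
  rewrite lebesgueN_eball//; case: i => [|[|[|i]]]; rewrite /level /r/=.
  - by rewrite lebesgueN_eball.
  - rewrite (lebesgueN_setD (measurable_eball _) (measurable_disc _ _) bump_sub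
      (lebesgueN_eball _ _) lebesgueN_bump)//.
    by rewrite rhoE expr1n mulrBl.
  - by rewrite lebesgueN_eball.
  - by rewrite !nth_nil lebesgueN_core.
rewrite (schwarz_layered q0 level_nested r0 _ _ _ levelE); [|rewrite /r/=; lra..].
set B := fun i => eball (r i).
have nB : nested B by split; apply: subset_eball; rewrite /r/=; lra.
rewrite !threshold_functional_layered//; [|by move=> i; exact: measurable_eball
  |exact: level_nested|exact: measurable_level].
rewrite level0D1.
set C := (\int[_]_(z in sym_rect (level 2) _) _)%E.
(* Levels 0 and 2 are already centered balls, so this contribution is literally the same for both
   functions; being finite, it cancels. *)
change (\int[_]_(z in sym_rect (B 2%N) _) _)%E with C.
have C0 : (0 <= C)%E by apply: integral_ge0 => z _; rewrite lee_fin kern_ge0.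
have C_lty : (C < +oo)%E by exact: integral_kern_far_lty.
have C_fin : C \is a fin_num by rewrite ge0_fin_numE.
pose a : R := (1 / 16) ^+ n.+1 * ball_volume n.
have a0 : 0 < a by rewrite mulr_gt0 ?ball_volume_gt0// exprn_gt0//; lra.
have m0 : 0 < 2 * (a * a) by apply: mulr_gt0 => //; exact: mulr_gt0.
pose s : R := n.+1%:R + p.
have s0 : 0 < s by rewrite addr_gt0// (lt_le_trans ltr01).
have mring : measurable (B 0%N `\` B 1%N).
  by apply: measurableD; exact: measurable_eball.
have ringE : lebesgueN n (B 0%N `\` B 1%N) = a%:E.
  rewrite (lebesgueN_setD (measurable_eball _) (measurable_eball _) _
    (lebesgueN_eball _ _) (lebesgueN_eball _ _))//; last first.
    exact: subset_eball.
  by rewrite /r/= rhoE expr1n /a; congr EFin; ring.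
have ring_core0 : (B 0%N `\` B 1%N) `&` B 3%N = set0.
  apply/seteqP; split => // x [[_ x1] x3]; apply: x1.
  by apply: subset_eball x3; rewrite /r/=; lra.
have bump_core0 : bump_set `&` level 3 = set0.
  by apply/seteqP; split => // x [/bump_far xb /core_sub].
have [mb mc] : measurable bump_set /\ measurable core_set.
  by split; exact: measurable_disc.
have r3E : lebesgueN n (B 3%N) = a%:E by rewrite lebesgueN_eball.
(* Bounds for the other contribution, all with the same product of measures: [A_ge] yields
   positivity, [A_le] and [A'_ge] the strict comparison through 17/16 < 5/4, [A'_le] finiteness.
   Here 17/16 = 1 + 1/16, and 7/16 = 1/2 - 1/16 is at most [rho] - 1/16. *)
have A_ge := integral_kern_ge delta0 p1 mb mc bump_core0 lebesgueN_bump
  lebesgueN_core (_ : forall x y, bump_set x -> core_set y -> enorm (x - y) <= 2).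
have A_le := integral_kern_le delta0 p1 mb mc bump_core0 lebesgueN_bump
  lebesgueN_core (_ : 0 < 5 / 4) bump_core_dist.
have A'_ge := integral_kern_ge delta0 p1 mring (measurable_eball _) ring_core0
  ringE r3E (_ : forall x y, _ -> _ -> enorm (x - y) <= 17 / 16).
have A'_le := integral_kern_le delta0 p1 mring (measurable_eball _) ring_core0
  ringE r3E (_ : 0 < 7 / 16) (_ : forall x y, _ -> _ -> 7 / 16 <= enorm (x - y)).
rewrite -/a in A_ge A_le A'_ge A'_le.
split.
- rewrite (lt_le_trans _ (leeDr _ C0))//; apply: lt_le_trans (A_ge _).
    by rewrite lte_fin mulr_gt0// divr_gt0 ?powR_gt0.
  move=> x y /bump_sub x1 /core_sub yh.
  apply: le_trans (ler_enormD _ _) _; rewrite enormN.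
  by move: x1 yh; rewrite /eball/=; lra.
- rewrite lteD2lE//; apply: le_lt_trans (A_le _) _; first lra.
  apply: lt_le_trans (A'_ge _).
    rewrite lte_fin ltr_pM2r// ltr_pM2l ?powR_gt0//.
    rewrite ltf_pV2 ?posrE ?powR_gt0//; try lra.
    by apply: gt0_ltr_powR; rewrite ?nnegrE//; lra.
  move=> x y [x1 _] y3; apply: le_trans (ler_enormD _ _) _; rewrite enormN.
  by move: x1 y3; rewrite /B /r /eball/=; lra.
- rewrite lte_add_pinfty//; apply: le_lt_trans (A'_le _ _) (ltry _); first lra.
  move=> x y [_ /negP]; rewrite -leNgt => x1 y3.
  apply: le_trans (ler_enorm_dist _ _).
  by move: x1 y3; rewrite /B /r /eball/=; lra.
Qed.

End example.

Theorem theorem1p1 (R : realType) (n : nat) (delta : R) (delta_gt0 : 0 < delta) :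
  exists u : {nnsfun 'rV[R]_n.+1 >-> R},
    [/\ compact (closure [set x : 'rV[R]_n.+1 | u x != 0]),
        finite_norm (lebesgueN n) +oo%E u,
        (range u #= `I_5)%card &
        forall p : R, 1 <= p ->
          [/\ (0 < threshold_functional delta p u)%E,
              (threshold_functional delta p u <
               threshold_functional delta p (schwarz_rearrangement u))%E &
              (threshold_functional delta p (schwarz_rearrangement u) <
               +oo)%E]].
Proof.
have q0 : 0 < delta / 4 by rewrite divr_gt0.
exists (level_nnsfun n (ltW q0)); split.
- by apply: compact_closure_eball1; exact: level_support.
- exact: finite_norm_level.
- exact: level_range.
- by move=> p; exact: threshold_functional_level_lt.
Qed.
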